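(* Let $k$ be a field with $u(k)\leq 2$ which is not quadratically closed, with $\mathrm{char}(k)\neq 2$ and $|k|\geq 5$. Let $\mathscr{C}$ be a conjugacy class in $\mathrm{SL}_2(k)$. Then, for $\overline{\epsilon_1}, \overline{\epsilon_2} \in k^{\times}/k^{\times 2}$ with $\overline{\epsilon_1}\neq \overline{\epsilon_2}$, $\mathscr{C}\subseteq U_{-1,\overline{\epsilon_1}}U_{-1,\overline{\epsilon_2}}$ if and only if one of the following holds: (1) $\mathscr{C}$ is a semisimple conjugacy class with $2-\mathrm{tr}(\mathscr{C})\in \epsilon_1\epsilon_2k^{\times 2}$; (2) $\mathscr{C}$ is a unipotent conjugacy class; (3) $\mathscr{C}=\{I\}$, $-1\notin k^{\times 2}$ and $\overline{\epsilon_2}=\overline{-\epsilon_1}$.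
   Context: A field $k$ has $u(k)\leq 2$ if every quadratic form in $3$ variables over $k$ is isotropic. A field is quadratically closed if it admits no quadratic extension. $k^{\times 2}$ is the set of squares in $k^\times$, and $\bar\epsilon$ is the image of $\epsilon\in k^\times$ in $k^\times/k^{\times2}$. $U_{-1,\overline{\epsilon}}$ denotes the $\mathrm{SL}_2(k)$-conjugacy class of $\begin{pmatrix}-1&\epsilon\\0&-1\end{pmatrix}$, which depends only on $\overline{\epsilon}$. The unipotent conjugacy classes are exactly the classes of the matrices $\begin{pmatrix}1&\epsilon\\0&1\end{pmatrix}$, $\epsilon\in k^\times$ (so $\{I\}$ is not counted as unipotent). Semisimple classes are non-central. $\mathrm{tr}(\mathscr{C})$ is the common trace of elements of $\mathscr{C}$. $AB=\{xy:x\in A,y\in B\}$. *)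

(* Defs.v *)
From HB Require Import structures.
From mathcomp Require Import all_boot all_order all_algebra all_field.
From mathcomp Require Import boolp classical_sets functions cardinality.

Set Implicit Arguments.
Unset Strict Implicit.
Unset Printing Implicit Defensive.

Import GRing.Theory.
Local Open Scope classical_set_scope.
Local Open Scope ring_scope.

Section Fields.
Variable k : fieldType.

(* The form \sum_(i, j) q_ij x_i x_j; the matrix q is not assumed symmetric
   and different matrices may define the same form. *)
Definition qform n (q : 'M[k]_n) (x : 'rV[k]_n) : k :=
  \sum_(i < n) \sum_(j < n) q i j * x 0 i * x 0 j.

Definition isotropic n (q : 'M[k]_n) : Prop :=
  exists2 x : 'rV[k]_n, x != 0 & qform q x = 0.

Definition u_le2 : Prop := forall q : 'M[k]_3, isotropic q.

Definition quadratically_closed : Prop :=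
  ~ exists L : fieldExtType k, \dim {:L} = 2%N.

(* The coset of e modulo the nonzero squares, for e != 0. *)
Definition sqclass (e : k) : set k := [set e * c ^+ 2 | c in [set c | c != 0]].

End Fields.

Section SpecialLinear.
Variable k : fieldType.
Implicit Types (A : 'M[k]_2) (C : set 'M[k]_2).

Definition SL2 : set 'M[k]_2 := [set g | \det g = 1].

Definition SL2_class A : set 'M[k]_2 :=
  [set g *m A *m invmx g | g in SL2].

Definition conjugacy_class C : Prop :=
  exists2 A, SL2 A & C = SL2_class A.

(* The matrix with rows (a, e) and (0, a). *)
Definition jordan2 (a e : k) : 'M[k]_2 := a%:M + e *: delta_mx 0 1.

Definition Ucl (a e : k) : set 'M[k]_2 := SL2_class (jordan2 a e).

Definition mulset (X Y : set 'M[k]_2) : set 'M[k]_2 :=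
  [set x *m y | x in X & y in Y].

(* Diagonalizable over the algebraic closure: a diagonalization involves
   finitely many elements, so it takes place over a finite extension of k. *)
Definition semisimple A : Prop :=
  exists L : fieldExtType k, diagonalizable (map_mx (in_alg L) A).

Definition central A : Prop := forall g, SL2 g -> g *m A = A *m g.

Definition semisimple_class C : Prop :=
  exists A, [/\ SL2 A, C = SL2_class A, semisimple A & ~ central A].

Definition unipotent_class C : Prop :=
  exists2 e : k, e != 0 & C = Ucl 1 e.

(* The trace of an arbitrarily chosen element of C; the trace is constant on
   conjugacy classes. *)
Definition class_trace C : k := \tr (xget 1%:M C).

End SpecialLinear.

(* Main.v *)
(** Let N(v) = v v^T J be the nilpotent matrix with image and kernel spanned by
    v. The class U_{-1,e} consists of the matrices -1 + e N(v), v != 0, and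
    (-1 + e1 N(v)) (-1 + e2 N(w)) has trace 2 - e1 e2 det(v, w)^2.
    If det(v, w) != 0 this trace is neither 2 nor, as e1 e2 is not a square, -2;
    and under u(k) <= 2 a trace t != 2, -2 determines a single class, because
    the quadratic form v |-> det(v, A v), of discriminant t^2 - 4, represents 1.
    If w = l v the product is 1 - (e1 + e2 l^2) N(v), and the unipotent case
    amounts to solving e1 x^2 + e2 y^2 + e z^2 = 0 with x, y, z all nonzero:
    u(k) <= 2 gives a nontrivial zero, and when one coordinate vanishes the form
    is a (x^2 - y^2) + b z^2, which has a zero of the required kind as soon as
    some s != 0 satisfies s^2 != b/a, -b/a; here b/a and -b/a are never both
    squares, so five elements suffice for that. *)

Require Import Defs.
From HB Require Import structures.
From mathcomp Require Import all_boot all_order all_algebra all_field.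
From mathcomp Require Import boolp classical_sets functions cardinality.
From mathcomp Require Import ring.

Set Implicit Arguments.
Unset Strict Implicit.
Unset Printing Implicit Defensive.

Import GRing.Theory.
Local Open Scope classical_set_scope.
Local Open Scope ring_scope.

(** * Invariants of 2 x 2 matrices, and roots in finite extensions *)

Lemma det_mx2 (R : comNzRingType) (A : 'M[R]_2) :
  \det A = A 0 0 * A 1 1 - A 0 1 * A 1 0.
Proof.
rewrite (expand_det_row _ 0) !big_ord_recl big_ord0 /= /cofactor !det_mx11.
rewrite !mxE /= /bump /= !addn0 expr0 expr1 mul1r addr0 mulN1r mulrN.
by congr (_ * A _ _ - A _ _ * A _ _); apply: val_inj.
Qed.

Lemma tr_mx2 (R : nzRingType) (A : 'M[R]_2) : \tr A = A 0 0 + A 1 1.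
Proof.
rewrite /mxtrace !big_ord_recl big_ord0 /= addr0.
by congr (_ + A _ _); apply: val_inj.
Qed.

Lemma char_poly_mx2 (F : fieldType) (A : 'M[F]_2) :
  char_poly A = 'X^2 - (\tr A) *: 'X + (\det A)%:P.
Proof.
rewrite /char_poly !det_mx2 !mxE /= tr_mx2.
rewrite -mul_polyC !(polyCD, polyCN, polyCM) !mulr1n !mulr0n.
by ring.
Qed.

(** In degree at most 3 a polynomial without roots is irreducible, so a root can be adjoined;
    otherwise the extension by the linear ['X - x] serves. *)
Lemma exists_root_fieldExt (F : fieldType) (p : {poly F}) :
    (1 < size p <= 4)%N ->
  exists (L : fieldExtType F) (z : L), root (map_poly (in_alg L) p) z.
Proof.
move=> sp; have [[x px]|pN] := pselect (exists x, root p x).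
  have [L _ [z zx _]] := irredp_FAdjoin (irredp_XsubC x); exists L, z.
  move/factor_theorem: px => [q ->].
  by rewrite rmorphM /= rootM zx orbT.
have /irredp_FAdjoin[L _ [z pz _]] : irreducible_poly p.
  by apply: cubic_irreducible => // x; apply/negP => px; apply: pN; exists x.
by exists L, z.
Qed.

Section Matrices.
Variable k : fieldType.
Implicit Types (a b c d e r x y : k) (A B D g : 'M[k]_2).

Definition mx22 a b c d : 'M[k]_2 :=
  \matrix_(i, j) if i == 0 then (if j == 0 then a else b)
                 else (if j == 0 then c else d).

Lemma mx22_eta A : A = mx22 (A 0 0) (A 0 1) (A 1 0) (A 1 1).
Proof.
apply/matrixP => -[[|[|//]] ?] [[|[|//]] ?]; rewrite mxE /=;
  by congr (A _ _); apply: val_inj.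
Qed.

Lemma mx22_inj a b c d a' b' c' d' :
  mx22 a b c d = mx22 a' b' c' d' -> [/\ a = a', b = b', c = c' & d = d'].
Proof.
move=> /matrixP E; have := (E 0 0, E 0 1, E 1 0, E 1 1).
by rewrite !mxE /= => -[[[]]].
Qed.

Lemma mulmx22 a b c d a' b' c' d' : mx22 a b c d *m mx22 a' b' c' d' =
  mx22 (a * a' + b * c') (a * b' + b * d') (c * a' + d * c') (c * b' + d * d').
Proof.
by rewrite [LHS]mx22_eta !mxE !big_ord_recr !big_ord0 /= !mxE /= !add0r.
Qed.

Lemma det_mx22 a b c d : \det (mx22 a b c d) = a * d - b * c.
Proof. by rewrite det_mx2 !mxE. Qed.

Lemma tr_mx22 a b c d : \tr (mx22 a b c d) = a + d.
Proof. by rewrite tr_mx2 !mxE. Qed.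

Lemma scalar_mx22 a : a%:M = mx22 a 0 0 a.
Proof. by rewrite [LHS]mx22_eta !mxE. Qed.

Lemma jordan2E a e : jordan2 a e = mx22 a e 0 a.
Proof.
by rewrite [LHS]mx22_eta /jordan2 !mxE /= ?mulr1 ?mulr0 ?addr0 ?add0r ?mulr0n.
Qed.

Definition mx22E := (mulmx22, det_mx22, tr_mx22, scalar_mx22, jordan2E).

(** * Conjugacy under SL2 and products of classes *)

Lemma SL2_unitmx g : SL2 g -> g \in unitmx.
Proof. by rewrite unitmxE => ->; rewrite unitr1. Qed.

Lemma SL2_classP A B :
  SL2_class A B <-> exists2 g, \det g = 1 & g *m A = B *m g.
Proof.
split=> [[g g1 <-]|[g g1 gA]]; have gu := SL2_unitmx g1.
  by exists g; rewrite ?mulmxKV.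
by exists g => //; rewrite gA mulmxK.
Qed.

Lemma SL2_class_refl A : SL2_class A A.
Proof. by apply/SL2_classP; exists 1%:M; rewrite ?det1 ?mul1mx ?mulmx1. Qed.

Lemma SL2_class_trans A B D :
  SL2_class A B -> SL2_class B D -> SL2_class A D.
Proof.
move=> /SL2_classP[g g1 gA] /SL2_classP[h h1 hB]; apply/SL2_classP.
by exists (h *m g); rewrite ?det_mulmx ?g1 ?h1 ?mulr1 // -mulmxA gA !mulmxA hB.
Qed.

Lemma SL2_class_sym A B : SL2_class A B -> SL2_class B A.
Proof.
move=> [g g1 <-]; have gu := SL2_unitmx g1.
apply/SL2_classP; exists (invmx g); first by rewrite det_inv g1 invr1.
by rewrite !mulmxA mulVmx // mul1mx.
Qed.

Lemma SL2_class_eq A B : SL2_class A B -> SL2_class A = SL2_class B.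
Proof.
move=> AB; apply/seteqP; split=> D; last exact: SL2_class_trans.
exact/SL2_class_trans/SL2_class_sym.
Qed.

Lemma SL2_class_tr A B : SL2_class A B -> \tr B = \tr A.
Proof.
move=> [g g1 <-]; have gu := SL2_unitmx g1.
by rewrite mxtrace_mulC mulmxA mulVmx // mul1mx.
Qed.

Lemma SL2_class_det A B : SL2_class A B -> \det B = \det A.
Proof. by case=> g g1 <-; rewrite !det_mulmx det_inv g1 invr1 mul1r mulr1. Qed.

Lemma class_traceE A : class_trace (SL2_class A) = \tr A.
Proof. exact/SL2_class_tr/(xgetI _ (SL2_class_refl A)). Qed.

Lemma SL2_class_scalar a : SL2_class a%:M = [set a%:M].
Proof.
apply/seteqP; split=> [B|B ->]; last exact: SL2_class_refl.
move=> [g g1 <-] /=; have gu := SL2_unitmx g1.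
by rewrite scalar_mxC mulmxK.
Qed.

Lemma mulset_SL2_class A B D E : SL2_class D E ->
  mulset (SL2_class A) (SL2_class B) D -> mulset (SL2_class A) (SL2_class B) E.
Proof.
move=> [g g1 <-] [x Ax [y By <-]]; have gu := SL2_unitmx g1.
have cl X : SL2_class X (g *m X *m invmx g) by exists g.
exists (g *m x *m invmx g); first exact: SL2_class_trans Ax (cl _).
exists (g *m y *m invmx g); first exact: SL2_class_trans By (cl _).
by rewrite !mulmxA mulmxKV.
Qed.

Lemma SL2_class_sub_mulset A B D :
  (SL2_class D `<=` mulset (SL2_class A) (SL2_class B)) <->
  mulset (SL2_class A) (SL2_class B) D.
Proof.
split=> [|DAB E DE]; first by apply; exact: SL2_class_refl.
exact: mulset_SL2_class DAB.
Qed.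

(* [-ac, a^2; -c^2, ac] is the nilpotent rank one matrix v v^T J, v = (a, c). *)
Definition jordan_conj r e a c : 'M[k]_2 :=
  mx22 (r - e * (a * c)) (e * a ^+ 2) (- (e * c ^+ 2)) (r + e * (a * c)).

Lemma det1_col a c : (a, c) != (0, 0) -> exists b d, a * d - b * c = 1.
Proof.
move=> ac0; have [a0|a0] := eqVneq a 0.
  have c0 : c != 0 by apply: contraNneq ac0 => ->; rewrite a0.
  by exists (- c^-1), 0; rewrite a0; field.
by exists 0, a^-1; field.
Qed.

(** Conjugating the Jordan block by [g] gives [r + e N(v)] with [v] the first column of [g], and
    every nonzero [v] is such a column by [det1_col]. *)
Lemma UclP r e A :
  Ucl r e A <-> exists a c, (a, c) != (0, 0) /\ A = jordan_conj r e a c.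
Proof.
split=> [/SL2_classP[g]|[a [c [ac0 ->]]]].
  rewrite (mx22_eta g); set a := g 0 0; set b := g 0 1; set c := g 1 0.
  set d := g 1 1; rewrite mx22E => g1 gA; exists a, c; split.
    apply: contra_eq_neq g1 => -[-> ->].
    by rewrite mul0r mulr0 subrr eq_sym oner_eq0.
  have gu : mx22 a b c d \in unitmx by rewrite unitmxE mx22E g1 unitr1.
  apply: (can_inj (mulmxK gu)); rewrite -gA /jordan_conj !mx22E.
  move/eqP: g1; rewrite subr_eq => /eqP g1; congr mx22; ring: g1.
apply/SL2_classP.
have [b [d g1]] := det1_col ac0.
exists (mx22 a b c d); first by rewrite mx22E.
move/eqP: g1; rewrite subr_eq => /eqP g1.
by rewrite /jordan_conj !mx22E; congr mx22; ring: g1.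
Qed.

(** Over an extension with an eigenvalue [z], the other one is [t - z]; they differ, so the minimal
    polynomial divides a product of distinct linear factors. *)
Lemma semisimple_mx2 A : (\tr A) ^+ 2 != 4 * \det A -> semisimple A.
Proof.
move=> disc; have [|L [z]] := @exists_root_fieldExt _ (char_poly A).
  by rewrite size_char_poly.
rewrite map_char_poly char_poly_mx2 det_map_mx trace_map_mx /=.
set t := (\tr A)%:A; set e := (\det A)%:A; rewrite rootE !hornerE => zE.
exists L; apply/diagonalizableP; exists [:: z; t - z].
  rewrite /= andbT inE; apply: contraNneq disc => zt.
  rewrite -subr_eq0 -(fmorph_eq0 (in_alg L)).
  (* If [t = 2z], then [t^2 - 4e] is [-4] times the value of the characteristic polynomial at
     [z]. *)
  rewrite rmorphB rmorphM rmorphXn rmorph_nat /= -/t -/e.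
  rewrite -(mulr0 (-4)) -(eqP zE) (_ : t = z + z); last by rewrite {1}zt subrK.
  by apply/eqP; ring.
apply: dvdp_trans (mxminpoly_dvd_char _) _; rewrite char_poly_mx2.
rewrite det_map_mx trace_map_mx /= -/t -/e !big_cons big_nil mulr1.
rewrite (_ : e = z * (t - z)); last first.
  by apply/eqP; rewrite -subr_eq0 -(eqP zE); apply/eqP; ring.
rewrite -mul_polyC polyCM !polyCB.
have -> : 'X^2 - t%:P * 'X + z%:P * (t%:P - z%:P) =
          ('X - z%:P) * ('X - (t%:P - z%:P)) by ring.
exact: dvdpp.
Qed.

(** Commuting with the two elementary transvections is enough. *)
Lemma central_mx2 A : central A -> exists a, A = a%:M.
Proof.
rewrite (mx22_eta A); set a := A 0 0; set b := A 0 1; set c := A 1 0.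
set d := A 1 1 => cA.
have := cA (mx22 1 1 0 1); have := cA (mx22 1 0 1 1).
pose simp := (mul0r, mulr0, mul1r, mulr1, addr0, add0r).
rewrite /SL2 /= !mx22E !simp => /(_ ltac:(ring)) /mx22_inj[E _ _ _].
move=> /(_ ltac:(ring)) /mx22_inj[E' E'' _ _].
exists a; rewrite mx22E; congr mx22.
- by apply: (addrI a); rewrite addr0.
- by apply: (addrI a); rewrite addr0.
- by apply: (addrI b); rewrite [RHS]addrC.
Qed.

Lemma not_central_mx2 A : (\tr A) ^+ 2 != 4 * \det A -> ~ central A.
Proof.
move=> disc /central_mx2[a AE]; move/eqP: disc; apply.
by rewrite AE !mx22E; ring.
Qed.

(** * Products of two Jordan-type elements, and square classes *)

Lemma tr_mul_jordan_conj e e' a c a' c' :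
  \tr (jordan_conj (-1) e a c *m jordan_conj (-1) e' a' c') =
  2 - e * e' * (a * c' - c * a') ^+ 2.
Proof. by rewrite /jordan_conj !mx22E; ring. Qed.

Lemma mul_jordan_conj e e' a c x y :
  jordan_conj (-1) e (x * a) (x * c) *m jordan_conj (-1) e' (y * a) (y * c) =
  jordan_conj 1 (- (e * x ^+ 2 + e' * y ^+ 2)) a c.
Proof. by rewrite /jordan_conj !mx22E; congr mx22; ring. Qed.

Lemma collinear2 a c a' c' : (a, c) != (0, 0) -> a * c' - c * a' = 0 ->
  exists l, a' = l * a /\ c' = l * c.
Proof.
move=> /det1_col[b [d ad]] /eqP; rewrite subr_eq0 => /eqP col.
(* Cramer's rule: the first coordinate of [(a', c')] in the basis [(a, c)], [(b, d)]. *)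
exists (a' * d - b * c').
by split; rewrite -[LHS]mulr1 -ad; ring: col.
Qed.

Lemma sqclass_eqP e e' :
  sqclass e = sqclass e' <-> exists2 c, c != 0 & e = e' * c ^+ 2.
Proof.
split=> [ee'|[c c0 ->]].
  have : sqclass e e by exists 1; rewrite /= ?oner_neq0// expr1n mulr1.
  by rewrite ee' => -[c c0 <-]; exists c.
apply/seteqP; split=> [_ [d d0 <-]|_ [d d0 <-]].
  by exists (c * d); rewrite /= ?mulf_neq0 // exprMn mulrA.
by exists (d / c); rewrite /= ?mulf_neq0 ?invr_neq0 //; field.
Qed.

End Matrices.

(** * Zeros of ternary forms, and conjugacy determined by the trace *)

Section SmallU.
Variable k : fieldType.
Implicit Types (a b e m p q r s : k) (A B : 'M[k]_2).

Lemma exists_notin (s : seq k) :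
  (`I_5 #<= [set: k])%card -> (size s < 5)%N -> exists x, x \notin s.
Proof.
move=> k5 s5; apply: contrapT => /forallNP sT.
have : ([set: k] #<= [set` s])%card.
  by apply: subset_card_le => x _ /=; apply: contrapT => /negP /sT.
move=> /(card_le_trans k5) k5s.
have : ([set` s] #<= `I_(size s))%card.
  apply/(card_le_trans _ (card_image_le (nth 0 s) `I_(size s))).
  apply: subset_card_le => x /= xs; exists (index x s); last exact: nth_index.
  by rewrite /= index_mem.
by move=> /(card_le_trans k5s); rewrite card_le_II leqNgt s5.
Qed.

Hypothesis card_k : (`I_5 #<= [set: k])%card.

Lemma exists_sqr_neq m : exists2 s, s != 0 & s ^+ 2 != m.
Proof.
have [[c <-]|mN] := pselect (exists c, c ^+ 2 = m).
  have [s] := @exists_notin [:: 0; c; - c] card_k isT.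
  rewrite !inE !negb_or => /and3P[s0 sc sNc]; exists s => //.
  by rewrite eqf_sqr negb_or sc.
exists 1; first exact: oner_neq0.
by apply/eqP => m1; apply: mN; exists 1.
Qed.

Lemma exists_sqr_neq2 m : ~ (exists c d, c ^+ 2 = m /\ d ^+ 2 = - m) ->
  exists s, [/\ s != 0, s ^+ 2 != m & s ^+ 2 != - m].
Proof.
move=> mN; have [[c cm]|cm] := pselect (exists c, c ^+ 2 = m).
  have [s s0 sm] := exists_sqr_neq m; exists s; split=> //.
  by apply/eqP => dm; apply: mN; exists c, s.
have [s s0 sm] := exists_sqr_neq (- m); exists s; split=> //.
by apply/eqP => dm; apply: cm; exists s.
Qed.

Hypothesis k2 : (2 : k) != 0.

Lemma diag3_zero a b : a != 0 ->
    ~ (exists c d, c ^+ 2 = b / a /\ d ^+ 2 = - (b / a)) ->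
  exists x y z, [/\ x != 0, y != 0, z != 0 &
    a * (x ^+ 2 - y ^+ 2) + b * z ^+ 2 = 0].
Proof.
move=> a0 /exists_sqr_neq2[s [s0 sm sNm]].
(* With [m = b / a], factor [y^2 - x^2 = m z^2] as [y - x = 2m], [y + x = 2 s^2], [z = 2s]. *)
exists (s ^+ 2 - b / a), (s ^+ 2 + b / a), (2 * s); split; last by field.
- by rewrite subr_eq0.
- by rewrite addr_eq0.
- exact: mulf_neq0.
Qed.

Hypothesis u_k : u_le2 k.

Lemma ternary_zero p q r s : exists x y z,
  ~ [/\ x = 0, y = 0 & z = 0] /\
  p * x ^+ 2 + q * x * y + r * y ^+ 2 + s * z ^+ 2 = 0.
Proof.
(* The matrix is triangular, so the cross term is [q x y] without a factor 2. *)
pose M : 'M[k]_3 := \matrix_(i, j)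
  if i == j then [:: p; r; s]`_i else if (i == 0) && (j == 1) then q else 0.
have [v v0 Mv] := u_k M; pose x i := v 0 (inord i).
have vE j : v 0 j = x j by rewrite /x inord_val.
exists (x 0%N), (x 1%N), (x 2%N); split.
  move=> [x0 x1 x2]; move/eqP: v0; apply; apply/matrixP => i j.
  by rewrite ord1 mxE vE; case: j => -[|[|[|//]]].
rewrite -Mv /qform; under eq_bigr do under eq_bigr do rewrite !vE.
rewrite !big_ord_recl !big_ord0 /= !mxE /=.
by rewrite /bump /=; ring.
Qed.

Lemma ternary_zero_neq0 a b e :
    a != 0 -> b != 0 -> e != 0 -> (forall c, b != a * c ^+ 2) ->
  exists x y z, [/\ x != 0, y != 0, z != 0 &
    a * x ^+ 2 + b * y ^+ 2 + e * z ^+ 2 = 0].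
Proof.
move=> a0 b0 e0 abN; have [x [y [z [xyz0 xyzE]]]] := ternary_zero a 0 b e.
move: xyzE; rewrite !mul0r addr0.
have [z0|z0] := eqVneq z 0.
  rewrite z0 expr0n mulr0 addr0 => xyE.
  have y0 : y != 0.
    apply: contra_not_neq xyz0 => y0; split=> //; apply/eqP.
    move/eqP: xyE; rewrite y0 expr0n mulr0 addr0.
    by rewrite mulf_eq0 (negPf a0) sqrf_eq0.
  have x0 : x != 0.
    apply/eqP => x0; move/eqP: xyE.
    by rewrite x0 expr0n mulr0 add0r mulf_eq0 (negPf b0) sqrf_eq0 (negPf y0).
  have bE : b = - a * (x / y) ^+ 2.
    by apply: (mulIf (expf_neq0 2 y0)); rewrite -[RHS]addr0 -xyE; field.
  have [|X [Y [Z [X0 Y0 Z0 XYZ]]]] := @diag3_zero a e a0.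
    move=> [c [d [cE dE]]].
    have c0 : c != 0 by rewrite -sqrf_eq0 cE mulf_neq0 ?invr_neq0.
    (* Here [-1 = (d / c)^2], which turns [b = - a (x / y)^2] into a square multiple of [a]. *)
    have /eqP[] := abN (d / c * (x / y)).
    have N1 : -1 = (d / c) ^+ 2.
      by rewrite expr_div_n cE dE; field; rewrite e0 a0.
    by rewrite exprMn -N1 bE; ring.
  exists X, (Y * y / x), Z; split=> //; first by rewrite !mulf_neq0 ?invr_neq0.
  by rewrite -XYZ bE; field; rewrite x0 y0.
(* Serves both [x = 0] and [y = 0]: then [e] is [- b'] times a square, and [a' / b'] is not a
   square, as [diag3_zero] requires. *)
have sub (a' b' x' y' : k) :
    a' != 0 -> b' != 0 -> (forall c, a' != b' * c ^+ 2) ->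
    x' = 0 -> a' * x' ^+ 2 + b' * y' ^+ 2 + e * z ^+ 2 = 0 ->
  exists x y z, [/\ x != 0, y != 0, z != 0 &
    a' * x ^+ 2 + b' * y ^+ 2 + e * z ^+ 2 = 0].
  move=> a'0 b'0 abN' ->; rewrite expr0n mulr0 add0r => yzE.
  have y'0 : y' != 0.
    apply/eqP => y'0; move/eqP: yzE.
    by rewrite y'0 expr0n mulr0 add0r mulf_eq0 (negPf e0) sqrf_eq0 (negPf z0).
  have eE : e = - b' * (y' / z) ^+ 2.
    by apply: (mulIf (expf_neq0 2 z0)); rewrite -[RHS]addr0 -yzE; field.
  have [|X [Y [Z [X0 Y0 Z0 XYZ]]]] := @diag3_zero b' a' b'0.
    move=> [c [_ [cE _]]]; have /eqP[] := abN' c.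
    by rewrite cE; field.
  exists Z, X, (z * Y / y'); split=> //; first by rewrite !mulf_neq0 ?invr_neq0.
  by rewrite -XYZ eE; field; rewrite y'0 z0.
have [x0|x0] := eqVneq x 0.
  move=> xyzE; apply: (sub a b x y) => // c; apply/eqP => aE.
  have c0 : c != 0 by apply: contraNneq a0 => c0; rewrite aE c0 expr0n mulr0.
  by have /eqP[] := abN c^-1; rewrite aE; field.
have [y0|y0 xyzE] := eqVneq y 0; last by exists x, y, z.
rewrite [_ * x ^+ 2 + _]addrC => /(sub b a y x b0 a0 abN y0).
move=> [X [Y [Z [X0 Y0 Z0 XYZ]]]].
by exists Y, X, Z; split=> //; rewrite -XYZ; ring.
Qed.

(** Take a zero of [Q - z^2]. If [z = 0], then [Q] has an isotropic vector [v]; completing it by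
    [w], the value [Q(s v + w) = s B + Q(w)] is affine in [s] with [B] nonzero. *)
Lemma binary_represents1 p q r : q ^+ 2 != 4 * p * r ->
  exists x y, p * x ^+ 2 + q * x * y + r * y ^+ 2 = 1.
Proof.
move=> disc; have [x [y [z [xyz0 xyzE]]]] := ternary_zero p q r (-1).
have [z0|z0] := eqVneq z 0; last first.
  exists (x / z), (y / z); apply: (mulIf (expf_neq0 2 z0)); rewrite mul1r.
  by apply/eqP; rewrite -subr_eq0 -xyzE; apply/eqP; field.
have [b [d]] : exists b d, x * d - b * y = 1.
  by apply: det1_col; apply/eqP => -[x0 y0]; apply: xyz0.
move=> /eqP; rewrite subr_eq => /eqP xd.
have vE : p * x ^+ 2 + q * x * y + r * y ^+ 2 = 0.
  by rewrite -[RHS]xyzE z0; ring.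
pose B := 2 * p * x * b + q * (x * d + b * y) + 2 * r * y * d.
pose Qw := p * b ^+ 2 + q * b * d + r * d ^+ 2.
(* The discriminant is invariant under SL2: it equals [B^2 - 4 Q(v) Q(w)], and [Q(v) = 0]. *)
have B0 : B != 0.
  rewrite -sqrf_eq0 -(_ : q ^+ 2 - 4 * p * r = B ^+ 2) ?subr_eq0//.
  rewrite -[LHS]mulr1 -(expr1n _ 2) -[in X in _ * X](addrK (b * y) 1) -xd.
  rewrite -[LHS]addr0 -[X in _ + X](mulr0 (4 * Qw)) -vE /B /Qw; ring.
exists ((1 - Qw) / B * x + b), ((1 - Qw) / B * y + d).
set s := (1 - Qw) / B.
rewrite [LHS](_ : _ =
  s ^+ 2 * (p * x ^+ 2 + q * x * y + r * y ^+ 2) + (s * B + Qw)).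
  by rewrite vE mulr0 add0r /s divfK // subrK.
by rewrite /B /Qw; ring.
Qed.

(* If Q(v) = det(v, A v) equals 1, the basis (v, A v) has determinant 1 and
   turns A into its companion matrix; Q has discriminant tr(A)^2 - 4. *)
Lemma SL2_class_companion A : \det A = 1 -> (\tr A) ^+ 2 != 4 ->
  SL2_class (mx22 0 (-1) 1 (\tr A)) A.
Proof.
rewrite (mx22_eta A); set a := A 0 0; set b := A 0 1; set c := A 1 0.
set d := A 1 1; rewrite !mx22E => A1 tA.
have [|x [y xyE]] := @binary_represents1 c (d - a) (- b).
  apply: contra_neq tA => disc.
  suff -> : (a + d) ^+ 2 = 4 * (a * d - b * c) by rewrite A1 mulr1.
  have -> : (a + d) ^+ 2 = (d - a) ^+ 2 + 4 * (a * d) by ring.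
  by rewrite disc; ring.
apply/SL2_classP; exists (mx22 x (a * x + b * y) y (c * x + d * y)).
  by rewrite mx22E -xyE; ring.
move/eqP: A1; rewrite subr_eq => /eqP A1.
by rewrite !mx22E; congr mx22; ring: A1.
Qed.

Lemma SL2_class_trE A B : \det A = 1 -> \det B = 1 -> \tr A = \tr B ->
  (\tr A) ^+ 2 != 4 -> SL2_class A B.
Proof.
move=> A1 B1 AB tA; have := SL2_class_companion A1 tA; rewrite AB => CA.
apply: SL2_class_trans (SL2_class_sym CA) (SL2_class_companion B1 _).
by rewrite -AB.
Qed.

End SmallU.

Theorem proposition3p17 (k : fieldType)
  (u_k : u_le2 k) (nqc_k : ~ quadratically_closed k)
  (char_k : 2%N \notin [pchar k]) (card_k : (`I_5 #<= [set: k])%card)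
  (C : set 'M[k]_2) (conj_C : conjugacy_class C)
  (e1 e2 : k) (e1_neq0 : e1 != 0) (e2_neq0 : e2 != 0)
  (e12 : sqclass e1 <> sqclass e2) :
  C `<=` mulset (Ucl (-1) e1) (Ucl (-1) e2) <->
  [\/ semisimple_class C /\ sqclass (e1 * e2) (2 - class_trace C),
      unipotent_class C
    | [/\ C = [set 1%:M], ~ sqclass 1 (-1 : k) & sqclass e2 = sqclass (- e1)]].
Proof.
have k2 : (2 : k) != 0 by apply: contraNneq char_k => k20; rewrite inE /= k20.
have e12N c : e1 != e2 * c ^+ 2.
  apply/eqP => e1E; apply/e12/sqclass_eqP; exists c => //.
  by apply: contraNneq e1_neq0 => c0; rewrite e1E c0 expr0n mulr0.
have e21N c : e2 != e1 * c ^+ 2.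
  apply/eqP => e2E; have c0 : c != 0.
    by apply: contraNneq e2_neq0 => c0; rewrite e2E c0 expr0n mulr0.
  by have /eqP[] := e12N c^-1; rewrite e2E; field.
(* Trace [-2] would give [e1 e2 c^2 = 4], placing [e1] in the square class of [e2]. *)
have disc (D : 'M_2) c : \det D = 1 -> c != 0 -> 2 - \tr D = e1 * e2 * c ^+ 2 ->
    (\tr D) ^+ 2 != 4.
  move=> D1 c0 trD; rewrite -subr_eq0.
  rewrite (_ : _ - 4 = (2 - \tr D) * (2 - \tr D - 4)); last by ring.
  rewrite trD !mulf_eq0 !negb_or e1_neq0 e2_neq0 c0 /= subr_eq0.
  apply/eqP => e4; have /eqP[] := e12N (2 / (e2 * c)).
  have -> : e1 = (e1 * e2 * c ^+ 2) / (e2 * c ^+ 2).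
    by field; rewrite e2_neq0 c0.
  by rewrite e4; field; rewrite e2_neq0 c0.
have det_mul A B : Ucl (-1) e1 A -> Ucl (-1) e2 B -> \det (A *m B) = 1.
  move=> /SL2_class_det A1 /SL2_class_det B1.
  by rewrite det_mulmx A1 B1 !mx22E; ring.
case: conj_C => D; rewrite /SL2 /= => D1 CE.
rewrite {C}CE class_traceE SL2_class_sub_mulset; split.
- move=> [_ /UclP[a [c [ac ->]]] [_ /UclP[a' [c' [ac' ->]]] DE]].
  have := tr_mul_jordan_conj e1 e2 a c a' c'; rewrite DE.
  have [col _|ncol trD] := eqVneq (a * c' - c * a') 0.
    have [l [a'E c'E]] := collinear2 ac col.
    have l0 : l != 0 by apply: contraNneq ac' => l0; rewrite a'E c'E l0 !mul0r.
    have := mul_jordan_conj e1 e2 a c 1 l.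
    rewrite !mul1r -a'E -c'E DE expr1n mulr1; set f := - _ => Df.
    have [f0|f0] := eqVneq f 0.
      have D1M : D = 1%:M by rewrite Df f0 /jordan_conj mx22E; congr mx22; ring.
      have e1E : e1 = - (e2 * l ^+ 2).
        by apply/eqP; rewrite -addr_eq0 -oppr_eq0 -/f f0.
      apply: Or33; split; first by rewrite D1M SL2_class_scalar.
        (* If [-1 = s^2], then [e1 = - e2 l^2] is [e2 (s l)^2]. *)
        move=> [s _]; rewrite mul1r => s1; have /eqP[] := e12N (s * l).
        by rewrite exprMn s1 e1E; ring.
      by apply/sqclass_eqP; exists l^-1; rewrite ?invr_neq0// e1E; field.
    apply: Or32; exists f => //; apply/esym/SL2_class_eq/UclP.
    by exists a, c.
  have trD' : 2 - \tr D = e1 * e2 * (a * c' - c * a') ^+ 2 by rewrite trD; ring.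
  have Ddisc := disc _ _ D1 ncol trD'; apply: Or31; split; last first.
    by exists (a * c' - c * a').
  exists D; split => //; first by apply: semisimple_mx2; rewrite D1 mulr1.
  by apply: not_central_mx2; rewrite D1 mulr1.
(* Multiples of [(1, 0)], in the shape expected by [mul_jordan_conj]. *)
- have U e x : x != 0 -> Ucl (-1) e (jordan_conj (-1) e (x * 1) (x * 0)).
    move=> x0; apply/UclP; exists (x * 1), (x * 0); split=> //.
    by apply: contra_neq x0 => -[+ _]; rewrite mulr1.
  case=> [[_ [c c0 cE]]|[f f0 Df]|[D1M _ /sqclass_eqP[c c0 e2E]]].
  (* The vectors [(1, 0)] and [(0, c)] have determinant [c], so the product has the trace of [D]. *)
  + have U1 : Ucl (-1) e1 (jordan_conj (-1) e1 1 0).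
      apply/UclP; exists 1, 0; split=> //.
      by apply: contra_neq (oner_neq0 k) => -[].
    have U2 : Ucl (-1) e2 (jordan_conj (-1) e2 0 c).
      by apply/UclP; exists 0, c; split=> //; apply: contra_neq c0 => -[].
    have PM : mulset (Ucl (-1) e1) (Ucl (-1) e2)
        (jordan_conj (-1) e1 1 0 *m jordan_conj (-1) e2 0 c).
      exists (jordan_conj (-1) e1 1 0) => //.
      by exists (jordan_conj (-1) e2 0 c).
    apply: mulset_SL2_class _ PM.
    have trE : \tr D = 2 - e1 * e2 * c ^+ 2 by rewrite cE; ring.
    apply: (SL2_class_trE u_k); rewrite ?det_mul //.
      by rewrite tr_mul_jordan_conj trE; ring.
    rewrite tr_mul_jordan_conj mul1r mul0r subr0 -trE.
    exact: disc _ _ D1 c0 (esym cE).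
  (* Dividing the zero by [z] gives the coefficient [f]; nonzero [x] and [y] keep both factors in
     their classes. *)
  + have [x [y [z [x0 y0 z0 xyz]]]] :=
      ternary_zero_neq0 card_k k2 u_k e1_neq0 e2_neq0 f0 e21N.
    have DU : SL2_class (jordan2 1 f) D.
      by rewrite -[SL2_class _]Df; exact: SL2_class_refl.
    apply: mulset_SL2_class DU _.
    exists (jordan_conj (-1) e1 (x / z * 1) (x / z * 0)).
      by apply: U; rewrite mulf_neq0 ?invr_neq0.
    exists (jordan_conj (-1) e2 (y / z * 1) (y / z * 0)).
      by apply: U; rewrite mulf_neq0 ?invr_neq0.
    rewrite mul_jordan_conj.
    have -> : - (e1 * (x / z) ^+ 2 + e2 * (y / z) ^+ 2) = f.
      by apply: (mulIf (expf_neq0 2 z0)); rewrite -[LHS]addr0 -xyz; field.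
    by rewrite /jordan_conj mx22E; congr mx22; ring.
  + have -> : D = 1%:M by have := SL2_class_refl D; rewrite D1M.
    (* Since [e2 = - e1 c^2], the multipliers [c] and [1] make [e1 c^2 + e2] vanish. *)
    exists (jordan_conj (-1) e1 (c * 1) (c * 0)); first exact: U.
    exists (jordan_conj (-1) e2 (1 * 1) (1 * 0)); first exact/U/oner_neq0.
    by rewrite mul_jordan_conj e2E /jordan_conj !mx22E; congr mx22; ring.
Qed.
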